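(* Let $n$ be a positive integer and let $\epsilon>0$ be a real number. There are, up to isomorphism, only finitely many finite simple groups $G$ containing an involution $t$ such that $$[C_G(t):O(C_G(t))]=n$$ and $$|G|>(1+\epsilon)\,|C_G(t)|^2\,|\mathcal{I}(C_G(t))|.$$
   Context: An involution is an element of order $2$. $C_G(t)$ denotes the centralizer of $t$ in $G$. For a finite group $H$, $O(H)=O_{2'}(H)$ denotes the largest normal subgroup of $H$ of odd order, and $\mathcal{I}(H)$ denotes the set of involutions in $H$. *)

(* Defs.v *)
From HB Require Import structures.
From mathcomp Require Import all_boot all_order all_algebra all_fingroup all_solvable.
From mathcomp Require Import reals.

Set Implicit Arguments.
Unset Strict Implicit.
Unset Printing Implicit Defensive.

Local Open Scope group_scope.

Definition involution (gT : finGroupType) (t : gT) : bool := #[t] == 2.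

Definition involutions (gT : finGroupType) (H : {set gT}) : {set gT} :=
  [set x in H | involution x].

(* Finite groups range over all {group gT}, with the ambient gT varying too, so
   the finitely many representatives may each live in a different gT. *)
Definition finitely_many_up_to_isog
    (P : forall gT : finGroupType, {group gT} -> Prop) : Prop :=
  exists (N : nat) (hT : 'I_N -> finGroupType) (H : forall i, {group hT i}),
    forall (gT : finGroupType) (G : {group gT}), P gT G -> exists i, G \isog H i.

(* Main.v *)
Require Import Defs.
From HB Require Import structures.
From mathcomp Require Import all_boot all_order all_algebra all_fingroup all_solvable.
From mathcomp Require Import reals.
From mathcomp Require Import all_field all_character.
From mathcomp Require Import ring zify.

(** Write C for the centralizer of t, O for O(C), K for the conjugacy class of
    t, and S for the 2-section of t, that is, the set of elements of G whose
    2-part lies in K.  The plan is to find a nontrivial irreducible character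
    of G whose degree is bounded in terms of n and eps, and then to bound |G|
    by Jordan's argument on finite linear groups.

    The counting ([exists_small_irr]).  If a and b lie in K and x = ab lies in
    S, then a inverts x, hence centralizes the 2-part of x, which is a
    conjugate of t.  So there are at most |I(C)| |S| such pairs.  By the class
    algebra formula their number is also |K|^2 / |G| times the sum over all
    irreducible chi of chi(t)^2 chi(S) / chi(1), where chi(S) is the sum of chi
    over S.  The trivial character contributes |G| |S| / |C|^2 to this, which
    exceeds (1 + eps) |I(C)| |S| by hypothesis, so the other characters make a
    negative contribution of comparable size.  Since |chi(S)| <= n |S|, by the
    orthogonality relations, some chi(1) is bounded as soon as the sum of
    chi(t)^2 over those chi with chi(S) <> 0 is.

    The 2-adic step.  Two facts are needed, for a set B of irreducible
    characters containing the trivial one: chi(S) = 0 for chi outside B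
    ([section_sum_block_eq0]), and the sum of chi(t)^2 over B is at most n
    ([sum_block_involution_sqr_le]).  For B the principal 2-block they would
    follow from the second and third main theorems of Brauer.  Here is a direct
    argument.  The sum of all elements of odd order of G acts on chi as an
    integer r_chi, and B is the set of chi with r_chi odd.  For x and y in G
    and N = 2^k, the sum over chi of r_chi^N chi(x^-1) chi(y) is the number of
    sequences h_0, ..., h_(N-1) in G such that, with h_N = x h_0 y^-1, all the
    quotients h_j^-1 h_(j+1) have odd order ([card_twisted_walks_cayley]).
    Rotation (h_0, ..., h_(N-1)) |-> (h_1, ..., h_N) preserves this set, and its
    N-th power is h |-> x h y^-1 in each entry; so every orbit has size
    divisible by 2^(k+1), except when an odd power of h |-> x h y^-1 fixes all
    the entries ([dvdn_card_twisted_walks]).  On the other hand r_chi^N tends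
    2-adically to 1 or 0 according to whether chi is in B or not.
    - For x in S and y outside S there is no exception, and letting k grow
      shows that B-part and non-B-part of the orthogonality relation between S
      and its complement vanish separately; the latter is minus the sum of
      chi(S)^2 over chi outside B.
    - For x = y = t the exceptions are the sequences in C.  Letting k grow
      identifies the sum of chi(t)^2 over B with the sum of psi(1)^2 over the
      set B of the group C.  The set of odd order elements of C is a union of
      cosets of O, so that the psi in question have O in their kernel, and the
      sum is at most |C : O| = n.

    The linear group step ([card_repr_le]).  Make the representation unitary.
    If x <> 1 is as close to 1 as possible in Hilbert-Schmidt norm and that
    distance is less than 1/2, then the commutators of x with its conjugates
    are even closer to 1, hence trivial, and the conjugates of x generate an
    abelian normal subgroup.  So in a nonabelian simple group any two elements
    are at distance at least 1/2, and a grid argument on matrix entries bounds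
    their number in terms of the degree. *)

Set Implicit Arguments.
Unset Strict Implicit.
Unset Printing Implicit Defensive.

Import Order.TTheory GRing.Theory Num.Theory.

(** * Closed walks twisted by a map *)

Lemma dvdn_card_porbit (T : finType) (s : {perm T}) (A : {set T}) (d : nat) :
  (forall x, x \in A -> s x \in A) ->
  (forall x, x \in A -> d %| #|porbit s x|) -> d %| #|A|.
Proof.
move=> sA dA; rewrite -sum1_card (partition_big (porbit s) predT) //=.
apply: dvdn_sum => O _.
have [x /andP[Ax /eqP defO] | O0] :=
    pickP (fun x => (x \in A) && (porbit s x == O)); last first.
  by rewrite big_pred0.
suff ->: \sum_(i in A | porbit s i == O) 1 = #|O| by rewrite -defO dA.
rewrite -sum1_card; apply: eq_bigl => y; rewrite -{1}defO.
have -> : (porbit s y == porbit s x) = (y \in O) by rewrite eq_porbit_mem -defO.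
rewrite andb_idl // -defO => /porbitP[i ->].
elim: i => [|i IHi]; first by rewrite expg0 perm1.
by rewrite expgSr permM sA.
Qed.

Section Walks.

Variables (T : finType) (e : rel T).

(** Only the intermediate vertices are listed, so these walks have n + 1 edges. *)
Definition walks (n : nat) (a b : T) : nat :=
  #|[set w : n.-tuple T | path e a (rcons w b)]|.

Lemma walks0 a b : walks 0 a b = e a b.
Proof.
rewrite /walks; case eab: (e a b).
  rewrite (_ : [set _ | _] = setT) ?cardsT ?card_tuple //.
  by apply/setP=> w; rewrite !inE tuple0 /= eab.
rewrite (_ : [set _ | _] = set0) ?cards0 //.
by apply/setP=> w; rewrite !inE tuple0 /= eab.
Qed.

Lemma walksS n a b : walks n.+1 a b = \sum_c e a c * walks n c b.
Proof.
rewrite /walks -sum1_card (partition_big (fun w : n.+1.-tuple T => thead w) predT) //=.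
apply: eq_bigr => c _; rewrite -sum1_card big_distrr /=.
under eq_bigl do rewrite inE.
rewrite (reindex_onto (fun w : n.-tuple T => [tuple of c :: w])
           (fun w : n.+1.-tuple T => [tuple of behead w])) /=; last first.
  move=> w /andP[_ /eqP <-].
  by rewrite -tuple_eta.
under eq_bigl => w.
  rewrite theadE eqxx andbT (_ : [tuple of behead [tuple of c :: w]] == w); last first.
    by apply/eqP/val_inj.
  rewrite andbT; over.
under [RHS]eq_bigl do rewrite inE.
case: (e a c) => /=; last by rewrite big_pred0 // big1.
by apply: eq_bigr.
Qed.

Variable g : T -> T.

(** Indexed from 0, so that an element of [twisted_walks n] has n + 1 vertices
    and as many edges, the last edge ending at the image under g of the first
    vertex. *)
Definition twisted_walks (n : nat) : {set n.+1.-tuple T} :=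
  [set w | path e (thead w) (rcons (behead w) (g (thead w)))].

Lemma card_twisted_walks n : #|twisted_walks n| = \sum_a walks n a (g a).
Proof.
rewrite -sum1_card (partition_big (fun w : n.+1.-tuple T => thead w) predT) //=.
apply: eq_bigr => c _; rewrite /walks -sum1_card /=.
under eq_bigl do rewrite inE.
rewrite (reindex_onto (fun w : n.-tuple T => [tuple of c :: w])
           (fun w : n.+1.-tuple T => [tuple of behead w])) /=; last first.
  move=> w /andP[_ /eqP <-].
  by rewrite -tuple_eta.
apply: eq_bigl => w.
rewrite inE theadE eqxx andbT (_ : [tuple of behead [tuple of c :: w]] == w) ?andbT //.
by apply/eqP/val_inj.
Qed.

Hypotheses (g_inj : injective g) (g_e : forall a b, e (g a) (g b) = e a b).

Definition twisted_shift n (w : n.+1.-tuple T) : n.+1.-tuple T :=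
  [tuple of rcons (behead w) (g (thead w))].

Lemma twisted_shift_inj n : injective (@twisted_shift n).
Proof.
move=> u v /(congr1 val) /= /rcons_inj[eq_uv /g_inj eq_h].
by rewrite (tuple_eta u) (tuple_eta v) eq_h; apply/val_inj; rewrite /= eq_uv.
Qed.

Lemma twisted_shift_walks n (w : n.+1.-tuple T) :
  w \in twisted_walks n -> twisted_shift w \in twisted_walks n.
Proof.
rewrite !inE; case/tupleP: w => a w /=; rewrite !theadE.
case: w => -[|b w] /= sz_w.
  by rewrite !andbT /thead /= !(tnth_nth a) /= g_e.
rewrite /thead !(tnth_nth a) /= => /andP[eab].
by rewrite [path e b (rcons (rcons _ _) _)]rcons_path last_rcons => ->; rewrite g_e.
Qed.

Lemma val_iter_twisted_shift n (w : n.+1.-tuple T) j : j <= n.+1 ->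
  val (iter j (@twisted_shift n) w) = drop j w ++ map g (take j w).
Proof.
elim: j => [|j IHj] lt_jn; first by rewrite drop0 take0 cats0.
rewrite iterS; set u := iter j _ w in IHj *.
have{IHj} Du := IHj (ltnW lt_jn).
have sz_w: j < size w by rewrite size_tuple.
have a : T := thead w.
have: val (twisted_shift u) = rcons (behead (val u)) (g (head a (val u))).
  rewrite /= /thead (tnth_nth a) /=.
  by case: u {Du} => -[|? ?].
move=> ->; rewrite Du (drop_nth a sz_w) /=.
by rewrite (take_nth a sz_w) map_rcons -rcons_cat.
Qed.

(** A full turn of the rotation applies g to every vertex; this is what relates
    the orbits of the rotation to those of g. *)
Lemma val_iter_twisted_shift_full n (w : n.+1.-tuple T) m :
  val (iter (n.+1 * m) (@twisted_shift n) w) = map (iter m g) w.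
Proof.
elim: m => [|m IHm]; first by rewrite muln0 /= map_id.
rewrite mulnS iterD val_iter_twisted_shift // IHm.
by rewrite drop_oversize ?take_oversize ?size_map ?size_tuple // -map_comp.
Qed.

(** With N = 2 ^ k vertices, an orbit of the rotation whose length is not
    divisible by 2 ^ k.+1 has length dividing N m for some odd m, and then the
    m-th power of g fixes all the vertices. *)
Lemma dvdn_card_twisted_walks n k (F : {set T}) :
  n.+1 = 2 ^ k ->
  (forall x, g x \in F -> x \in F) ->
  (forall x m, odd m -> iter m g x = x -> x \in F) ->
  2 ^ k.+1 %| #|[set w in twisted_walks n | ~~ all (mem F) w]|.
Proof.
move=> Dn gF oddF; pose s := perm (@twisted_shift_inj n).
apply: (@dvdn_card_porbit _ s) => w.
  rewrite !inE permE => /andP[walk_w F'w]; apply/andP; split.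
    by have := @twisted_shift_walks n w; rewrite !inE; apply.
  apply: contra F'w => /=; rewrite all_rcons => /andP[/gF Fh].
  by rewrite [in X in _ -> X](tuple_eta w) /= Fh.
rewrite inE => /andP[_ F'w]; set L := #|_|.
have L_gt0 : 0 < L by apply/card_gt0P; exists w; apply: porbit_id.
(* The odd part of the orbit length L serves as the exponent of g. *)
apply: contraR F'w => F'L; pose m := L`_2^'.
have odd_m : odd m by rewrite -[odd m]negbK -dvdn2 -prime.p'natE ?part_pnat.
have dvL : L %| n.+1 * m.
  rewrite Dn -[L](partnC 2) // dvdn_pmul2r ?part_gt0 //.
  rewrite p_part dvdn_Pexp2l // leqNgt; apply: contra F'L => lt_kl.
  by rewrite -[L](partnC 2) // p_part dvdn_mulr // dvdn_exp2l.
have fix_w : iter (n.+1 * m) (@twisted_shift n) w = w.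
  have itP j u : iter j s u = iter j (@twisted_shift n) u.
    by elim: j => //= j ->; rewrite permE.
  rewrite -itP; have /dvdnP[q ->] := dvL.
  elim: q => //= q IHq; rewrite mulSn iterD IHq.
  by rewrite /L iter_porbit.
apply/allP=> x w_x; apply: (oddF x m) => //.
have /(congr1 val) := fix_w; rewrite val_iter_twisted_shift_full /= => fix_map.
have /eq_in_map := etrans fix_map (esym (map_id w)); exact.
Qed.

End Walks.

Local Open Scope group_scope.

(** * Characters and walks in Cayley graphs *)

Section CentralCharacters.

Local Open Scope ring_scope.
Variables (gT : finGroupType) (G : {group gT}).
Implicit Types (i : Iirr G) (D : {set gT}).

(** Schur's lemma: a sum of elements that is invariant under conjugation acts
    as a scalar. *)
Lemma irr_central_sum i (I : finType) (P : pred I) (f : I -> gT) y :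
  (forall j, P j -> f j \in G) ->
  (forall h, h \in G ->
     \sum_(j | P j) 'Chi_i (f j ^ h)%g = \sum_(j | P j) 'Chi_i (f j)) ->
  y \in G ->
  \sum_(j | P j) 'chi_i (f j * y)%g
     = (\sum_(j | P j) 'chi_i (f j)) / 'chi_i 1%g * 'chi_i y.
Proof.
move=> Gf fJ Gy; set M := (\sum_(j | P j) 'Chi_i (f j))%R in fJ.
have chiE x : x \in G -> 'chi_i x = \tr ('Chi_i x).
  by move=> Gx; rewrite -irrRepr cfunE Gx mulr1n.
have /is_scalar_mxP[c defM] : is_scalar_mx M.
  apply: (mx_abs_irr_cent_scalar (groupC (socle_irr (socle_of_Iirr i)))).
  apply/centgmxP=> h Gh; rewrite -{2}(fJ h Gh) mulmx_suml mulmx_sumr.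
  by apply: eq_bigr => j Pj; rewrite -!repr_mxM ?groupJ ?Gf // -conjgC.
have sumE z : z \in G -> \sum_(j | P j) 'chi_i (f j * z)%g = c * 'chi_i z.
  move=> Gz; rewrite (chiE z Gz) -mxtraceZ -mul_scalar_mx -defM mulmx_suml.
  rewrite raddf_sum /=; apply: eq_bigr => j Pj.
  by rewrite chiE ?groupM ?Gf // repr_mxM ?Gf.
have := sumE 1%g (group1 G); under eq_bigr do rewrite mulg1.
by rewrite sumE // => ->; rewrite mulfK ?irr1_neq0.
Qed.

(** The scalar by which the sum of the elements of D acts, when D is a union of
    conjugacy classes. *)
Definition central_value D i : algC := (\sum_(v in D) 'chi_i v) / 'chi_i 1%g.

Lemma irr_sum_mulg D i y :
  D \subset G -> G \subset 'N(D) -> y \in G ->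
  \sum_(v in D) 'chi_i (v * y)%g = central_value D i * 'chi_i y.
Proof.
move=> sDG nDG Gy; apply: irr_central_sum => // [v /(subsetP sDG)//|h Gh].
rewrite [RHS](reindex_inj (conjg_inj h)) /=; apply: eq_bigl => v.
by rewrite memJ_norm // (subsetP nDG).
Qed.

Lemma irr_sum_conj i x y : x \in G -> y \in G ->
  \sum_(h in G) 'chi_i (x ^ h * y)%g
     = #|G|%:R * 'chi_i x * 'chi_i y / 'chi_i 1%g.
Proof.
move=> Gx Gy; rewrite irr_central_sum // => [|h Gh|k Gk].
- rewrite (eq_bigr (fun=> 'chi_i x)) => [|h Gh]; last by rewrite cfunJ.
  by rewrite sumr_const -[_ *+ _]mulr_natl [LHS]mulrAC.
- by rewrite groupJ.
rewrite [RHS](reindex_inj (mulIg k)) /=; apply: eq_big => h.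
  by rewrite groupMr.
by rewrite conjgM.
Qed.

Lemma sum_irr1_irr x :
  \sum_i 'chi[G]_i 1%g * 'chi_i x = #|G|%:R *+ (x == 1)%g.
Proof.
have := cfRegE G x; rewrite cfReg_sum sum_cfunE => <-.
by apply: eq_bigr => i _; rewrite cfunE.
Qed.

(** Edges start in G, since the ambient type may have further elements. *)
Definition cayley_edge D : rel gT :=
  [rel a b | (a \in G) && (a^-1 * b \in D)%g].

(** The action of G x G on G by left and right multiplication. *)
Definition twist (x y h : gT) : gT := (x * h * y^-1)%g.

Section Cayley.

Variable D : {set gT}.
Hypotheses (sDG : D \subset G) (nDG : G \subset 'N(D)).

(** The eigenvalues of the Cayley graph are the central values of D; the n.+1
    edges of a walk with n intermediate vertices account for the exponent. *)
Lemma walks_cayley n a b : a \in G -> b \in G ->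
  (walks (cayley_edge D) n a b)%:R
    = (\sum_i 'chi[G]_i 1%g * central_value D i ^+ n.+1 * 'chi_i (b^-1 * a)%g)
        / #|G|%:R :> algC.
Proof.
move=> Ga Gb.
elim: n a Ga => [|n IHn] a Ga.
  rewrite walks0 /cayley_edge /= Ga /=.
  under eq_bigr => i _.
    rewrite expr1 -mulrA -irr_sum_mulg ?groupM ?groupV // mulr_sumr; over.
  rewrite exchange_big /=.
  under eq_bigr do rewrite sum_irr1_irr.
  have eqE v : (v * (b^-1 * a) == 1)%g = (v == a^-1 * b)%g.
    by rewrite [RHS]eq_mulgV1 invMg invgK.
  under eq_bigr do rewrite eqE.
  case: (boolP (a^-1 * b \in D)%g) => Dab.
    rewrite (bigD1 (a^-1 * b)%g) //= eqxx big1 ?addr0 ?divff ?neq0CG //.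
    by move=> v /andP[_ /negPf->].
  rewrite big1 ?mul0r // => v Dv; case: eqP => // Dv'.
  by rewrite -Dv' Dv in Dab.
rewrite walksS natr_sum.
transitivity (\sum_(v in D) (walks (cayley_edge D) n (a * v)%g b)%:R : algC).
  rewrite (reindex_inj (mulgI a)) /= [RHS]big_mkcond; apply: eq_bigr => v _.
  by rewrite /cayley_edge /= Ga mulKg /=; case: ifP => _; rewrite ?mul1n ?mul0n.
under eq_bigr => v Dv do rewrite IHn ?groupM ?(subsetP sDG v Dv) //.
rewrite -mulr_suml exchange_big; congr (_ / _); apply: eq_bigr => i _.
rewrite -mulr_sumr [in RHS]exprSr mulrA -[RHS]mulrA; congr (_ * _).
rewrite -irr_sum_mulg ?groupM ?groupV //; apply: eq_bigr => v Dv.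
have Gv := subsetP sDG v Dv.
by rewrite -[LHS](cfunJ 'chi_i _ (groupVr Gv)) conjgE invgK !mulgA mulgK.
Qed.

(** The trace of the product of a power of the adjacency operator with the
    permutation h |-> x h y^-1, in terms of the decomposition of the group
    algebra into matrix algebras. *)
Lemma card_twisted_walks_cayley n x y : x \in G -> y \in G ->
  #|twisted_walks (cayley_edge D) (twist x y) n|%:R
    = \sum_i central_value D i ^+ n.+1 * 'chi[G]_i x^-1%g * 'chi_i y :> algC.
Proof.
move=> Gx Gy; rewrite card_twisted_walks natr_sum.
have G0 h : h \notin G -> walks (cayley_edge D) n h (twist x y h) = 0%N.
  move=> G'h; apply/eqP; rewrite cards_eq0; apply/eqP/setP=> w; rewrite !inE.
  by case: (val w) => [|c u]; rewrite /cayley_edge /= (negPf G'h).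
rewrite (bigID (mem G)) /= [X in _ + X]big1 ?addr0; last first.
  by move=> h /G0->.
transitivity (\sum_(h in G) (\sum_i 'chi[G]_i 1%g * central_value D i ^+ n.+1 *
    'chi_i (x^-1 ^ h * y)%g) / #|G|%:R).
  apply: eq_bigr => h Gh; rewrite walks_cayley ?groupM ?groupV //.
  congr (_ / _); apply: eq_bigr => i _; congr (_ * _).
  rewrite -[LHS](cfunJ 'chi_i _ Gy); congr ('chi_i _).
  by rewrite /twist !conjgE !invMg !invgK !mulgA mulVg mul1g.
rewrite -mulr_suml exchange_big /= mulr_suml; apply: eq_bigr => i _.
rewrite -mulr_sumr irr_sum_conj ?groupV //.
have nz1 : 'chi_i 1%g != 0 := irr1_neq0 i.
have nzG : #|G|%:R != 0 :> algC := neq0CG G.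
rewrite [RHS]mulrAC.
move: ('chi_i 1%g) nz1 (central_value D i) => d nz_d r; field; exact/andP.
Qed.

End Cayley.

End CentralCharacters.

(** * Rationality of character sums *)

Section Rationality.

Local Open Scope ring_scope.
Variables (gT : finGroupType) (G : {group gT}).

(** Such sets are invariant under the maps x |-> x ^+ k with k prime to the order
    of the group, through which the Galois group acts on character values; so
    sums of characters over them are rational. *)
Definition cyclic_saturated (A : {set gT}) : Prop :=
  forall x y : gT, x \in A -> <[x]>%g = <[y]>%g -> y \in A.

Lemma sum_by_cycles (phi : gT -> algC) (A : {set gT}) :
  cyclic_saturated A ->
  (forall x, x \in A -> \sum_(y | <[y]>%g == <[x]>%g) phi y \in Num.int) ->
  \sum_(x in A) phi x \in Num.int.
Proof.
move=> satA intA; rewrite (partition_big (fun x => <[x]>%g) predT) //=.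
apply: rpred_sum => C _.
have [x /andP[Ax /eqP defC] | C0] :=
  pickP (fun x => (x \in A) && (<[x]>%g == C)); last by rewrite big_pred0 ?rpred0.
rewrite (eq_bigl (fun y => <[y]>%g == <[x]>%g)) ?intA // => y.
rewrite defC andb_idl // => /eqP defC'.
by apply: (satA x) => //; rewrite defC.
Qed.

(** The sum over the whole cyclic group is an integer, being a multiplicity of
    the trivial character times an order; the other elements generate smaller
    cyclic groups. *)
Lemma char_sum_generators_Cint (chi : 'CF(G)) x :
  chi \is a character -> x \in G ->
  \sum_(y | <[y]>%g == <[x]>%g) chi y \in Num.int.
Proof.
move=> Nchi; have [n] := ubnP #[x]%g; elim: n x => // n IHn x lt_xn Gx.
have sxG : <[x]>%g \subset G by rewrite cycle_subG.
have int_all : \sum_(y in <[x]>%g) chi y \in Num.int.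
  have ->: \sum_(y in <[x]>%g) chi y = #[x]%:R * '['Res[<[x]>%g] chi, 1].
    rewrite cfdotE mulVKf ?neq0CG //; apply: eq_bigr => y x_y.
    by rewrite cfResE // cfun1E x_y conjC1 mulr1.
  rewrite rpredM ?rpred_nat // -irr0 intr_nat ?Cnat_cfdot_char_irr //.
  exact: cfRes_char.
have int_proper : \sum_(y in [set y in <[x]>%g | <[y]>%g != <[x]>%g]) chi y
    \in Num.int.
  apply: sum_by_cycles => [y z | y]; rewrite !inE => /andP[x_y ne_yx].
    by move=> defz; rewrite -defz ne_yx andbT -cycle_subG -defz cycle_subG.
  apply: IHn; last by rewrite (subsetP sxG).
  apply: leq_trans (_ : #[x]%g <= n)%N; last by rewrite -ltnS.
  apply: proper_card; rewrite properEneq ne_yx /=.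
  by rewrite cycle_subG.
move: int_all; rewrite (bigID (fun y => <[y]>%g == <[x]>%g)) /=.
have /rpredDr -> : \sum_(y in <[x]> | <[y]>%g != <[x]>%g) chi y \in Num.int.
  have -> : \sum_(y in <[x]> | <[y]>%g != <[x]>%g) chi y
      = \sum_(y in [set y in <[x]>%g | <[y]>%g != <[x]>%g]) chi y.
    by apply: eq_bigl => y; rewrite inE.
  exact: int_proper.
rewrite (eq_bigl (fun y => <[y]>%g == <[x]>%g)) // => y.
by rewrite andb_idl // => /eqP <-; apply: cycle_id.
Qed.

Lemma irr_sum_Cint (i : Iirr G) (A : {set gT}) :
  A \subset G -> cyclic_saturated A -> \sum_(x in A) 'chi_i x \in Num.int.
Proof.
move=> sAG satA; apply: sum_by_cycles => // x /(subsetP sAG) Gx.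
by apply: char_sum_generators_Cint => //; apply: irr_char.
Qed.

(** It is rational because D is saturated, and an algebraic integer because it
    is a sum of central values of conjugacy classes. *)
Lemma central_value_Cint (D : {set gT}) (i : Iirr G) :
  D \subset G -> G \subset 'N(D) -> cyclic_saturated D ->
  central_value D i \in Num.int.
Proof.
move=> sDG nDG satD; apply: Cint_rat_Aint.
  have /intrP[a Da] := irr_sum_Cint i sDG satD.
  have /natrP[d Dd] := Cnat_irr1 i.
  by rewrite /central_value Da Dd rpred_div ?rpred_int ?rpred_nat.
rewrite /central_value (partition_big (fun v => v ^: G) predT) //= mulr_suml.
apply: rpred_sum => C _.
have [x /andP[Dx /eqP defC] | C0] :=
  pickP (fun x => (x \in D) && (x ^: G == C)); last first.
  by rewrite big_pred0 // mul0r rpred0.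
rewrite (eq_bigl [in x ^: G]) => [|y]; last first.
  rewrite -defC; apply/andP/idP=> [[_ /eqP <-] | xGy]; first exact: class_refl.
  have [h Gh ->] := imsetP xGy.
  by rewrite memJ_norm ?(subsetP nDG) // classGidl.
rewrite (eq_bigr (fun=> 'chi_i x)) => [|_ /imsetP[h Gh ->]]; last by rewrite cfunJ.
by rewrite sumr_const -[_ *+ _]mulr_natl Aint_class_div_irr1 // (subsetP sDG).
Qed.

End Rationality.

(** * Powers of two *)

Section TwoAdic.

Local Open Scope ring_scope.

Lemma dvdz_pow2_sub1 (z : int) (k : nat) :
  ~~ (2 %| z)%Z -> (2 ^+ k.+1 %| z ^+ (2 ^ k) - 1)%Z.
Proof.
move=> odd_z; have even_pm b : (2 %| (z ^+ (2 ^ b) : int) + 1)%Z /\ (2 %| z ^+ (2 ^ b) - 1)%Z.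
  have: ~~ (2 %| z ^+ (2 ^ b))%Z by rewrite dvdzE abszX dvdn2 oddX expn_eq0 /= -dvdn2.
  move: (z ^+ _) => y; lia.
elim: k => [|k IHk]; first by have [] := even_pm 0%N.
rewrite expnS mulnC exprM (_ : _ - 1 = (z ^+ (2 ^ k) - 1) * (z ^+ (2 ^ k) + 1)); last by ring.
by rewrite exprSr dvdz_mul //; have [] := even_pm k.
Qed.

Lemma dvdz_pow2_even (z : int) (k : nat) :
  (2 %| z)%Z -> (2 ^+ k.+1 %| z ^+ (2 ^ k))%Z.
Proof.
move=> even_z; apply: (@dvdz_trans (2 ^+ (2 ^ k))); last exact: dvdz_exp2r.
by apply: dvdz_exp2l; apply: ltn_expl.
Qed.

(** The 2 ^ k-th powers of odd numbers tend 2-adically to 1, and those of even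
    numbers to 0. *)
Lemma sum_pow2_mod (I : finType) (z c : I -> int) (k : nat) :
  (2 ^+ k.+1 %| \sum_i z i ^+ (2 ^ k) * c i - \sum_(i | ~~ (2 %| z i)%Z) c i)%Z.
Proof.
rewrite [X in _ - X]big_mkcond -sumrB; apply: rpred_sum => i _.
case: ifPn => [odd_z | /negPn even_z].
  rewrite (_ : _ - _ = (z i ^+ (2 ^ k) - 1) * c i); last by ring.
  exact/dvdz_mulr/dvdz_pow2_sub1.
by rewrite subr0; apply/dvdz_mulr/dvdz_pow2_even.
Qed.

Lemma dvdz_pow2_all_eq0 (a : int) : (forall k, (2 ^+ k.+1 %| a)%Z) -> a = 0.
Proof.
move=> dva; apply/eqP; rewrite -absz_eq0 -leqn0 leqNgt; apply/negP=> a_gt0.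
have := dva `|a|%N; rewrite dvdzE abszX => /(dvdn_leq a_gt0).
by rewrite leqNgt (ltn_trans (ltnSn _)) // ltn_expl.
Qed.

End TwoAdic.

(** * Odd order elements and 2-sections *)

Section OddElements.

Variables (gT : finGroupType).
Implicit Types (G : {group gT}) (t : gT).

Definition odd_elements G : {set gT} := [set x in G | x.`_2 == 1].

Definition two_section G t : {set gT} := [set x in G | x.`_2 \in t ^: G].

Lemma odd_elements_sub G : odd_elements G \subset G.
Proof. by apply/subsetP=> x /setIdP[]. Qed.

Lemma two_section_sub G t : two_section G t \subset G.
Proof. by apply/subsetP=> x /setIdP[]. Qed.

Lemma odd_elements_norm G : G \subset 'N(odd_elements G).
Proof.
apply/subsetP=> h Gh; rewrite inE; apply/subsetP=> _ /imsetP[x /setIdP[Gx x1] ->].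
by rewrite inE groupJ //= consttJ (eqP x1) conj1g.
Qed.

Lemma odd_elements_saturated G : cyclic_saturated (odd_elements G).
Proof.
move=> x y /setIdP[Gx /eqP x1] defy; rewrite inE -cycle_subG -defy cycle_subG Gx /=.
have /cycleP[k ->] : y \in <[x]> by rewrite defy cycle_id.
by rewrite consttX x1 expg1n.
Qed.

Lemma expg_involution_odd t m : involution t -> odd m -> t ^+ m = t.
Proof.
move=> /eqP t2 odd_m; rewrite -[m]odd_double_half odd_m expgS -muln2 mulnC expgM.
by rewrite -t2 expg_order expg1n mulg1.
Qed.

Lemma involutionV t : involution t -> t^-1 = t.
Proof. by move=> /eqP t2; apply/eqP; rewrite eq_invg_mul -(expg_order t) t2 -expg2. Qed.

Lemma constt_involution t : involution t -> t.`_2 = t.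
Proof. by move=> /eqP t2; rewrite constt_p_elt // /p_elt t2. Qed.

Lemma involutionJ t h : involution (t ^ h) = involution t.
Proof. by rewrite /involution orderJ. Qed.

(** A 2-element s with an odd power of order 2 has order 2, so equals all its
    odd powers. *)
Lemma odd_exp_involution (s : gT) m :
  s.`_2 = s -> odd m -> involution (s ^+ m) -> s = s ^+ m.
Proof.
move=> s2 odd_m /eqP sm2; set t := s ^+ m.
have co_m : coprime #[s] m.
  by rewrite -s2 order_constt p_part coprimeXl // coprime2n.
have : #[s] = 2 by rewrite -sm2 orderXgcd (eqnP co_m) divn1.
by move=> /eqP inv_s; rewrite /t expg_involution_odd.
Qed.

Lemma two_section_saturated G t :
  involution t -> cyclic_saturated (two_section G t).
Proof.
move=> inv_t x y /setIdP[Gx /imsetP[h Gh x2]] defy.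
rewrite inE -cycle_subG -defy cycle_subG Gx /=.
have /cycleP[k Dy] : y \in <[x]> by rewrite defy cycle_id.
have odd_k : odd k.
  have : generator <[x]> (x ^+ k) by rewrite /generator -Dy defy.
  rewrite generator_coprime => /coprime_dvdl; rewrite -coprime2n; apply.
  have <- : #[x.`_2] = 2 by apply/eqP; rewrite x2 orderJ.
  exact/order_dvdG/cycle_constt.
rewrite Dy consttX x2 expg_involution_odd ?involutionJ //.
exact: imset_f.
Qed.

End OddElements.

(** * The principal 2-block *)

Section Block.

Variables (gT : finGroupType) (G : {group gT}).
Implicit Types (t x y : gT) (i : Iirr G).

Definition odd_sum_value i : int := Num.floor (central_value (odd_elements G) i).

Lemma odd_sum_valueE i : ((odd_sum_value i)%:~R = central_value (odd_elements G) i)%R.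
Proof.
apply: floorK; apply: central_value_Cint.
- exact: odd_elements_sub.
- exact: odd_elements_norm.
exact: odd_elements_saturated.
Qed.

(** The set B of the introduction.  It is the principal 2-block, which consists
    of the characters whose central values at class sums are congruent to those
    of the trivial character modulo a prime above 2: the sum of the odd
    order elements acts as 0 in all other blocks. *)
Definition in_principal_block i : bool := ~~ (2 %| odd_sum_value i)%Z.

(** Inversion has no fixed point among the nontrivial elements of odd order. *)
Lemma odd_card_odd_elements : odd #|odd_elements G|.
Proof.
have odd1 : 1 \in odd_elements G by rewrite inE group1 constt1 eqxx.
rewrite (cardsD1 1) odd1 /= -dvdn2.
have invK : involutive (@invg gT) by apply: invgK.
pose s := perm (can_inj invK); have sE y : s y = y^-1 by rewrite permE.
apply: (@dvdn_card_porbit _ s) => x; rewrite !inE ?sE.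
  by rewrite invg_eq1 groupV consttV invg_eq1.
case/and3P=> nt_x Gx /eqP x2.
suff -> : #|porbit s x| = 2 by [].
have sK : (s ^+ 2)%g = 1%g.
  by apply/permP=> y; rewrite expgS expg1 permM !sE invgK perm1.
rewrite (_ : porbit s x = [set x; x^-1]); last first.
  apply/setP=> y; rewrite !inE; apply/porbitP/orP.
    case=> k ->; rewrite -[k]odd_double_half expgD -muln2 mulnC expgM sK expg1n.
    by rewrite mulg1; case: (odd k); rewrite ?expg1 ?expg0 ?perm1 ?sE eqxx; auto.
  case=> /eqP->; first by exists 0%N; rewrite expg0 perm1.
  by exists 1%N; rewrite expg1 sE.
rewrite cards2 (_ : x != x^-1) //; apply: contra nt_x => /eqP x_inv.
have : x ^+ 2 == 1 by rewrite expg2 {2}x_inv mulgV.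
rewrite -order_dvdn => dv2; rewrite -order_eq1.
have : #[x] != 2.
  by apply/eqP=> o2; have := order_constt 2 x; rewrite x2 order1 o2 part_pnat_id.
by move: (order_gt0 x) (@dvdn_leq #[x] 2 isT dv2); case: #[x] => [|[|[|?]]].
Qed.

Lemma in_principal_block0 : in_principal_block (0 : Iirr G)%R.
Proof.
have : ((odd_sum_value 0%R)%:~R = (#|odd_elements G|)%:~R :> algC)%R.
  rewrite odd_sum_valueE /central_value irr0 cfun11 divr1.
  rewrite (eq_bigr (fun=> 1%R)) ?sumr_const ?pmulrn //.
  by move=> v /(subsetP (odd_elements_sub G)) Gv; rewrite cfun1E Gv.
move/intr_inj; rewrite /in_principal_block => ->.
by rewrite dvdzE /= dvdn2 odd_card_odd_elements.
Qed.

(** The edge relation forces its source to be in G, and every vertex of a closed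
    twisted walk is the source of an edge. *)
Lemma val_twisted_walk n x y (w : n.+1.-tuple gT) :
  x \in G -> y \in G ->
  w \in twisted_walks (cayley_edge G (odd_elements G)) (twist x y) n ->
  {subset w <= G}.
Proof.
move=> Gx Gy; rewrite inE.
have edgeG a b : cayley_edge G (odd_elements G) a b -> a \in G.
  by case/andP.
have pathG u : forall a z, path (cayley_edge G (odd_elements G)) a (rcons u z) ->
    {subset a :: u <= G}.
  elim: u => [|b u IHu] a z /= /andP[/edgeG Ga] walk c.
    by rewrite inE => /eqP->.
  by rewrite inE => /predU1P[-> // |]; apply: IHu walk c.
move=> /pathG wG c w_c; apply: wG.
by rewrite {1}(tuple_eta w) in w_c.
Qed.

Lemma iter_twist x y m h : iter m (twist x y) h = x ^+ m * h * y ^- m.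
Proof.
elim: m => [|m IHm]; first by rewrite !expg0 invg1 mulg1 mul1g.
by rewrite iterS IHm /twist !expgS invMg !mulgA.
Qed.

Lemma twist_inj x y : injective (twist x y).
Proof. by move=> a b /mulIg /mulgI. Qed.

Lemma twist_edge x y a b : x \in G -> y \in G ->
  cayley_edge G (odd_elements G) (twist x y a) (twist x y b)
    = cayley_edge G (odd_elements G) a b.
Proof.
move=> Gx Gy; rewrite /cayley_edge /twist /=.
rewrite groupMr ?groupV // groupMl //; congr (_ && _).
rewrite !invMg invgK -!mulgA mulKg mulgA -[RHS](memJ_norm _ (_ : y^-1 \in _)).
  by rewrite conjgE invgK !mulgA.
by rewrite groupV (subsetP (odd_elements_norm G)).
Qed.

End Block.

(** * Block orthogonality for a 2-section *)

Section BlockOrthogonality.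

Variables (gT : finGroupType) (G : {group gT}).
Implicit Types (t x y : gT) (i : Iirr G).

Local Notation edge := (cayley_edge G (odd_elements G)).

(** If an odd power of h |-> x h y^-1 fixed some h in G, then equal odd powers
    of x and y would be conjugate, and so would the 2-parts of x and y. *)
Lemma dvdn_section_walks t x y n k :
  n.+1 = (2 ^ k)%N -> involution t -> x \in two_section G t ->
  y \in G -> y \notin two_section G t ->
  2 ^ k.+1 %| #|twisted_walks edge (twist x y) n|.
Proof.
move=> Dn inv_t t_x Gy t'y.
have Gx := subsetP (two_section_sub G t) x t_x.
have [_ x2] := setIdP t_x.
have inv_x2 : involution x.`_2 by have [h _ ->] := imsetP x2; rewrite involutionJ.
have -> : twisted_walks edge (twist x y) n
          = [set w in twisted_walks edge (twist x y) n | ~~ all (mem (~: G)) w].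
  apply/setP=> w; rewrite [RHS]inE; case: (boolP (w \in _)) => //= walk_w.
  have /= wG := val_twisted_walk Gx Gy walk_w.
  symmetry; apply/allPn; exists (thead w); first by rewrite mem_tnth.
  by rewrite /= inE negbK wG ?mem_tnth.
apply: dvdn_card_twisted_walks Dn _ _.
- exact: twist_inj.
- by move=> a b; apply: twist_edge.
- by move=> h; rewrite !inE /twist groupMr ?groupV // groupMl.
move=> h m odd_m; rewrite iter_twist inE => fix_h.
apply: contra t'y => Gh.
have Dym : y ^+ m = (x ^+ m) ^ h.
  have xh : x ^+ m * h = h * y ^+ m by rewrite -{2}fix_h mulgKV.
  by rewrite conjgE xh mulKg.
have y2m : y.`_2 ^+ m = x.`_2 ^ h.
  by rewrite -consttX Dym consttJ consttX expg_involution_odd.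
have y2 : y.`_2 = y.`_2 ^+ m.
  apply: odd_exp_involution => //; last by rewrite y2m involutionJ.
  by rewrite constt_p_elt ?p_elt_constt.
rewrite inE Gy y2 y2m.
by have [g Gg ->] := imsetP x2; rewrite -conjgM imset_f ?groupM.
Qed.

Lemma two_section_inv t x : involution t ->
  (x^-1 \in two_section G t) = (x \in two_section G t).
Proof.
move=> inv_t; have sat := two_section_saturated inv_t.
by apply/idP/idP=> /sat; apply; rewrite cycleV.
Qed.

Lemma section_complement_saturated t : involution t ->
  cyclic_saturated (G :\: two_section G t).
Proof.
move=> inv_t x y /setDP[Gx t'x] defy; have Gy : y \in G.
  by rewrite -cycle_subG -defy cycle_subG.
rewrite inE Gy andbT; by apply: contra t'x => /two_section_saturated; apply.
Qed.

Local Open Scope ring_scope.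

Definition section_sum t i : algC := \sum_(x in two_section G t) 'chi_i x.

Definition cosection_sum t i : algC := \sum_(x in G :\: two_section G t) 'chi_i x.

Lemma section_sum_Cint t i : involution t -> section_sum t i \in Num.int.
Proof.
move=> inv_t; apply: irr_sum_Cint; first exact: two_section_sub.
exact: two_section_saturated.
Qed.

Lemma cosection_sum_Cint t i : involution t -> cosection_sum t i \in Num.int.
Proof.
move=> inv_t; apply: irr_sum_Cint; first exact: subsetDl.
exact: section_complement_saturated.
Qed.

(** The sum over the whole group vanishes for nontrivial characters; hence the
    two sums are opposite to each other for these. *)
Lemma section_sumD t i :
  section_sum t i + cosection_sum t i = #|G|%:R *+ (i == 0).
Proof.
transitivity (\sum_(x in G) 'chi_i x).
  rewrite [RHS](big_setID (two_section G t)) /=; congr (_ + _).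
  by rewrite (setIidPr (two_section_sub G t)).
transitivity (#|G|%:R * '['chi_i, 'chi_0]).
  rewrite cfdotE mulVKf ?neq0CG //; apply: eq_bigr => x Gx.
  by rewrite irr0 cfun1E Gx conjC1 mulr1.
by rewrite cfdot_irr mulr_natr; case: eqP.
Qed.

Lemma section_sum0 t : section_sum t 0 = #|two_section G t|%:R.
Proof.
rewrite /section_sum (eq_bigr (fun=> 1)) ?sumr_const //.
by move=> x /(subsetP (two_section_sub G t)) Gx; rewrite irr0 cfun1E Gx.
Qed.

(** Elements of the 2-section are not conjugate to elements outside it. *)
Lemma sum_section_cosection t :
  involution t -> \sum_i section_sum t i * cosection_sum t i = 0.
Proof.
move=> inv_t; transitivity (\sum_i section_sum t i * (cosection_sum t i)^*).
  apply: eq_bigr => i _; congr (_ * _).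
  by rewrite conj_intr ?cosection_sum_Cint.
transitivity (\sum_(x in two_section G t) \sum_(y in G :\: two_section G t)
    \sum_i 'chi[G]_i x * ('chi_i y)^*).
  under [RHS]eq_bigr do rewrite exchange_big.
  rewrite [RHS]exchange_big; apply: eq_bigr => i _ /=.
  rewrite mulr_suml; apply: eq_bigr => x _.
  by rewrite rmorph_sum /= mulr_sumr.
rewrite big1 // => x t_x; rewrite big1 // => y /setDP[Gy t'y].
rewrite second_orthogonality_relation //.
case: (boolP (x \in _)) => // xGy; case/negP: t'y.
have [Gx x2] := setIdP t_x; rewrite inE Gy.
have [h Gh Dx] := imsetP xGy.
have -> : y = (x ^ h^-1)%g by rewrite Dx -conjgM mulgV conjg1.
have [g Gg Dx2] := imsetP x2.
by rewrite consttJ Dx2 -conjgM imset_f ?groupM ?groupV.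
Qed.

(** The terms of this sum are integers, and dividing by every power of 2 forces
    it to vanish. *)
Lemma sum_block_section_cosection t : involution t ->
  \sum_(i : Iirr G | in_principal_block i) section_sum t i * cosection_sum t i = 0.
Proof.
move=> inv_t; pose c i : int := Num.floor (section_sum t i * cosection_sum t i).
have cE i : (c i)%:~R = section_sum t i * cosection_sum t i.
  by apply: floorK; rewrite rpredM ?section_sum_Cint ?cosection_sum_Cint.
suff c0 : \sum_(i : Iirr G | in_principal_block i) c i = 0.
  rewrite -[RHS](mulr0z 1) -c0 rmorph_sum /=.
  by apply: eq_bigr => i _; rewrite cE.
apply: dvdz_pow2_all_eq0 => k.
pose n := (2 ^ k).-1; have Dn : n.+1 = (2 ^ k)%N by rewrite prednK ?expn_gt0.
pose W := (\sum_(x in two_section G t) \sum_(y in G :\: two_section G t)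
  #|twisted_walks edge (twist x y) n|)%N.
have dvW : (2 ^+ k.+1 %| W%:Z)%Z.
  rewrite dvdzE abszX; apply: dvdn_sum => x t_x; apply: dvdn_sum => y /setDP[Gy t'y].
  exact: dvdn_section_walks Dn inv_t t_x Gy t'y.
have DW : \sum_i odd_sum_value i ^+ (2 ^ k) * c i = W%:Z.
  apply: (@intr_inj algC); rewrite rmorph_sum /= -pmulrn natr_sum.
  under [RHS]eq_bigr => x t_x.
    rewrite natr_sum; under eq_bigr => y /setDP[Gy t'y].
      rewrite card_twisted_walks_cayley ?(subsetP (two_section_sub G t) x) //;
        [over | exact: odd_elements_sub | exact: odd_elements_norm].
    rewrite exchange_big; over.
  rewrite [RHS]exchange_big; apply: eq_bigr => i _ /=.
  rewrite rmorphM rmorphXn /= cE odd_sum_valueE Dn.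
  rewrite [section_sum t i](reindex_inj invg_inj) /= mulr_suml mulr_sumr.
  rewrite (eq_bigl _ _ (fun x => two_section_inv x inv_t)).
  apply: eq_bigr => x _; rewrite !mulr_sumr; apply: eq_bigr => y _.
  by rewrite mulrA.
have := sum_pow2_mod (@odd_sum_value gT G) c k.
by rewrite DW => /(rpredB dvW); rewrite subKr.
Qed.

(** For characters outside the block, all of them nontrivial, the products in
    [sum_section_cosection] are the opposites of squares, and the sum of these
    over the complement of the block is zero. *)
Lemma section_sum_block_eq0 t i :
  involution t -> ~~ in_principal_block i -> section_sum t i = 0.
Proof.
move=> inv_t B'i.
have ST j : j != 0 -> section_sum t j * cosection_sum t j = - section_sum t j ^+ 2.
  move=> nz_j; have := section_sumD t j; rewrite (negPf nz_j) mulr0n addrC.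
  by move/eqP; rewrite addr_eq0 => /eqP->; rewrite mulrN expr2.
have := sum_section_cosection inv_t.
rewrite (bigID (@in_principal_block gT G)) /= sum_block_section_cosection // add0r.
have B'0 j : ~~ in_principal_block j -> j != 0.
  by apply: contraNneq => ->; apply: in_principal_block0.
rewrite (eq_bigr (fun j => - section_sum t j ^+ 2)) => [|j /B'0]; last exact: ST.
rewrite sumrN => /eqP; rewrite oppr_eq0 psumr_eq0 => [/allP/(_ i)|j _].
  by rewrite mem_index_enum B'i sqrf_eq0 => /(_ isT)/eqP.
by rewrite -realEsqr Rreal_int ?section_sum_Cint.
Qed.

Lemma sum_section_sum_sqr t : involution t ->
  \sum_i section_sum t i ^+ 2 = #|G|%:R * #|two_section G t|%:R.
Proof.
move=> inv_t.
transitivity (\sum_i (section_sum t i ^+ 2 + section_sum t i * cosection_sum t i)).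
  by rewrite big_split /= sum_section_cosection // addr0.
rewrite (bigD1 0) //= big1 ?addr0 => [|i nz_i]; rewrite expr2 -mulrDr section_sumD.
  by rewrite eqxx section_sum0 mulrC.
by rewrite (negPf nz_i) mulr0.
Qed.

End BlockOrthogonality.

(** * The principal 2-block of an involution centralizer *)

Section BlockOfCentralizer.

Variables (gT : finGroupType) (G : {group gT}).
Implicit Types (t x y : gT).

(** Multiplication by an element of O(G) preserves the image in G / O(G), so
    the 2-part of the product is both in O(G) and a 2-element. *)
Lemma odd_elements_mulr y v :
  y \in 'O_2^'(G) -> (v * y \in odd_elements G) = (v \in odd_elements G).
Proof.
have nsOG : 'O_2^'(G) <| G := pcore_normal _ _.
have half u z : z \in 'O_2^'(G) -> u \in odd_elements G -> u * z \in odd_elements G.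
  move=> Oz /setIdP[Gu /eqP u2].
  have Gz : z \in G := subsetP (normal_sub nsOG) z Oz.
  rewrite inE groupM //=.
  have nO x : x \in G -> x \in 'N('O_2^'(G)) := subsetP (normal_norm nsOG) x.
  set w := (u * z).`_2; have Gw : w \in G.
    by rewrite -cycle_subG (subset_trans (cycleX _ _)) // cycle_subG groupM.
  have Ow : w \in 'O_2^'(G).
    apply: coset_idr; first exact: nO.
    rewrite /w (morph_constt (coset_morphism _)) ?nO ?groupM //=.
    rewrite morphM ?nO //= (coset_id Oz) mulg1.
    by rewrite -(morph_constt (coset_morphism _)) ?nO //= u2 morph1.
  apply/eqP; rewrite -(@constt_p_elt _ 2 w) ?p_elt_constt //.
  by apply/constt1P; apply: mem_p_elt (pcore_pgroup _ _) Ow.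
move=> Oy; apply/idP/idP; last exact: half.
by move/(half _ _ (groupVr Oy)); rewrite mulgK.
Qed.

(** The sum of the odd order elements is invariant under multiplication by O(G),
    so O(G) acts trivially wherever this sum does not act as 0. *)
Lemma in_principal_block_pcore_sub_cfker (i : Iirr G) :
  in_principal_block i -> 'O_2^'(G) \subset cfker ('chi_i)%R.
Proof.
move=> Bi; apply/subsetP=> y Oy.
have Gy : y \in G := subsetP (pcore_sub _ _) y Oy.
have nz_r : (central_value (odd_elements G) i != 0)%R.
  by rewrite -odd_sum_valueE intr_eq0; apply: contraNneq Bi => ->.
rewrite cfkerEirr inE; apply/eqP; apply: (mulfI nz_r).
rewrite -irr_sum_mulg ?odd_elements_sub ?odd_elements_norm //.
rewrite divfK ?irr1_neq0 // (reindex_inj (mulIg y^-1)) /=.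
apply: eq_big => v; last by rewrite mulgKV.
by rewrite odd_elements_mulr // groupV.
Qed.

Local Notation core G := 'O_2^'(G).
Local Open Scope ring_scope.

Lemma sum_block_irr1_sqr :
  \sum_(i : Iirr G | in_principal_block i) 'chi_i 1%g ^+ 2 <= #|G : (core G)|%:R.
Proof.
have nsOG : (core G) <| G := pcore_normal _ _.
have : \sum_i `|'chi[G / (core G)]_i (coset _ 1%g)| ^+ 2 = #|G : (core G)|%:R.
  rewrite -card_quotient ?normal_norm // morph1.
  have := sum_irr1_irr (G / (core G))%G 1%g; rewrite eqxx mulr1n /= => <-.
  by apply: eq_bigr => i _; rewrite ger0_norm ?expr2 // ltW ?irr1_gt0.
rewrite sum_norm_irr_quo ?group1 // => <-.
rewrite [X in _ <= X]big_mkcond [X in X <= _]big_mkcond; apply: ler_sum => i _.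
case: ifP => [/in_principal_block_pcore_sub_cfker-> | _].
  by rewrite ger0_norm // ltW ?irr1_gt0.
by case: ifP => // _; rewrite exprn_ge0.
Qed.

End BlockOfCentralizer.

Section CentralizerReduction.

Local Notation core G := 'O_2^'(G).
Local Open Scope ring_scope.
Variables (gT : finGroupType) (G : {group gT}) (t : gT).
Hypotheses (Gt : t \in G) (inv_t : involution t).

Local Notation C := 'C_G[t]%G.

(** Closed walks twisted by conjugation by t, all of whose vertices commute
    with t, are closed walks in the Cayley graph of the centralizer.  Stating
    the condition as an implication makes it hold outside G, where the map
    h |-> t h t^-1 may have fixed points as well. *)
Lemma twisted_walks_centralizer n :
  [set w in twisted_walks (cayley_edge G (odd_elements G)) (twist t t) n |
     all (mem [set h | (h \in G) ==> (h \in C)]) w]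
  = twisted_walks (cayley_edge C (odd_elements C)) (twist 1 1)%g n.
Proof.
have edgeC a b : a \in C -> b \in C ->
    cayley_edge G (odd_elements G) a b = cayley_edge C (odd_elements C) a b.
  move=> Ca Cb; have Cab : (a^-1 * b)%g \in C by rewrite groupM ?groupV.
  have Gab := subsetP (subsetIl _ _) _ Cab.
  rewrite /cayley_edge /= Ca (subsetP (subsetIl _ _) _ Ca).
  by rewrite [in LHS]inE [in RHS]inE Gab Cab.
have twistC a : a \in C -> twist t t a = twist 1 1 a.
  by case/setIP=> _ /cent1P cta; rewrite /twist -cta mulgK invg1 mulg1 mul1g.
have twist11 a : twist 1 1 a = a by rewrite /twist invg1 mulg1 mul1g.
have pathC (w : n.+1.-tuple gT) : {subset w <= C} ->
    (w \in twisted_walks (cayley_edge G (odd_elements G)) (twist t t) n)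
    = (w \in twisted_walks (cayley_edge C (odd_elements C)) (twist 1 1)%g n).
  move=> Cw; rewrite !inE; have Ch : thead w \in C by rewrite Cw ?mem_tnth.
  rewrite twistC // twist11.
  apply: (@eq_in_path _ [in C] _ _ edgeC).
  apply/allP=> c; rewrite inE mem_rcons inE => /predU1P[->//|/predU1P[->//|]].
  by move/mem_behead=> /Cw.
apply/setP=> w; rewrite in_set; apply/andP/idP => [[walk_w /allP Fw] | walk_w].
  rewrite -pathC // => h w_h; have := Fw h w_h; rewrite /= inE => /implyP; apply.
  exact: val_twisted_walk walk_w h w_h.
have Cw : {subset w <= C}.
  by apply: val_twisted_walk walk_w; rewrite group1.
rewrite pathC //; split=> //; apply/allP=> h /Cw Ch.
by rewrite /= inE Ch implybT.
Qed.


Lemma irr_involution_Cint (i : Iirr G) : 'chi_i t \in Num.int.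
Proof.
have satt : cyclic_saturated [set t].
  move=> x y /set1P-> defy; rewrite inE.
  have /cycleP[k Dy] : y \in <[t]>%g by rewrite defy cycle_id.
  rewrite Dy expg_involution_odd //; rewrite -coprime2n -(eqP inv_t).
  by rewrite -generator_coprime /generator -Dy defy.
have := irr_sum_Cint i (_ : [set t] \subset G) satt.
by rewrite sub1set big_set1; apply.
Qed.

(** Both sides are integers, so it is enough to compare them modulo every power
    of 2, where they are congruent to numbers of closed walks in G, twisted by
    conjugation by t, and in its centralizer. *)
Lemma sum_block_involution_sqr :
  \sum_(i : Iirr G | in_principal_block i) 'chi_i t ^+ 2
    = \sum_(j : Iirr C | in_principal_block j) 'chi_j 1%g ^+ 2.
Proof.
pose a i : int := Num.floor ('chi[G]_i t ^+ 2).
pose b j : int := Num.floor ('chi[C]_j 1%g ^+ 2).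
have aE i : (a i)%:~R = 'chi[G]_i t ^+ 2.
  by apply: floorK; rewrite rpredX ?irr_involution_Cint.
have bE j : (b j)%:~R = 'chi[C]_j 1%g ^+ 2.
  by apply: floorK; rewrite rpredX // intr_nat ?Cnat_irr1.
suff /eqP : \sum_(i : Iirr G | in_principal_block i) a i
    - \sum_(j : Iirr C | in_principal_block j) b j = 0.
  rewrite subr_eq0 => /eqP/(congr1 (intr : int -> algC)); rewrite !rmorph_sum /=.
  by under eq_bigr do rewrite aE; under [in RHS]eq_bigr do rewrite bE.
apply: dvdz_pow2_all_eq0 => k.
pose n := (2 ^ k).-1; have Dn : n.+1 = (2 ^ k)%N by rewrite prednK ?expn_gt0.
pose WG := twisted_walks (cayley_edge G (odd_elements G)) (twist t t) n.
pose WC := twisted_walks (cayley_edge C (odd_elements C)) (twist 1 1)%g n.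
(* The elements of G fixed by an odd power of conjugation by t, and all elements
   outside G. *)
pose F := [set h | (h \in G) ==> (h \in C)].
have FE h : (h \in F) = ((h \in G) ==> (h \in C)) by rewrite in_set.
have Ct : t \in C by rewrite inE Gt cent1id.
have dvF : (2 ^ k.+1 %| #|[set w in WG | ~~ all (mem F) w]|)%N.
  apply: dvdn_card_twisted_walks Dn _ _.
  - exact: twist_inj.
  - by move=> x y; apply: twist_edge.
  - move=> h; rewrite !FE /twist groupMr ?groupV // groupMl //.
    by rewrite [_ \in C]groupMr ?groupV // groupMl.
  move=> h m odd_m; rewrite iter_twist expg_involution_odd // => fix_h.
  rewrite FE; apply/implyP=> Gh; rewrite inE Gh; apply/cent1P.
  by rewrite /commute -[in LHS]fix_h mulgKV.
have cardWG : #|WG| = (#|WC| + #|[set w in WG | ~~ all (mem F) w]|)%N.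
  rewrite /WC -twisted_walks_centralizer -/WG -/F.
  rewrite -(cardsID [set w : n.+1.-tuple gT | all (mem F) w] WG).
  by congr (_ + _)%N; apply: eq_card => w; rewrite !inE // andbC.
have sumG : \sum_i odd_sum_value i ^+ (2 ^ k) * a i = #|WG|%:Z.
  apply: (@intr_inj algC); rewrite rmorph_sum /= -pmulrn.
  rewrite card_twisted_walks_cayley ?odd_elements_sub ?odd_elements_norm //.
  apply: eq_bigr => i _.
  by rewrite rmorphM rmorphXn /= aE odd_sum_valueE Dn involutionV // expr2 mulrA.
have sumC : \sum_j odd_sum_value j ^+ (2 ^ k) * b j = #|WC|%:Z.
  apply: (@intr_inj algC); rewrite rmorph_sum /= -pmulrn.
  rewrite card_twisted_walks_cayley ?odd_elements_sub ?odd_elements_norm ?group1 //.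
  apply: eq_bigr => i _.
  by rewrite rmorphM rmorphXn /= bE odd_sum_valueE Dn invg1 expr2 mulrA.
have dvG := sum_pow2_mod (@odd_sum_value gT G) a k.
have dvC := sum_pow2_mod (@odd_sum_value gT C) b k.
have dvD : (2 ^+ k.+1 %| #|WG|%:Z - #|WC|%:Z)%Z.
  by rewrite cardWG PoszD addrC addKr dvdzE abszX.
rewrite sumG in dvG; rewrite sumC in dvC.
rewrite (_ : _ - _ = (#|WG|%:Z - #|WC|%:Z)
   - (#|WG|%:Z - \sum_(i : Iirr G | in_principal_block i) a i)
   + (#|WC|%:Z - \sum_(j : Iirr C | in_principal_block j) b j)); last by ring.
by apply: rpredD => //; apply: rpredB.
Qed.

Lemma sum_block_involution_sqr_le :
  \sum_(i : Iirr G | in_principal_block i) 'chi_i t ^+ 2 <= #|C : core C|%:R.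
Proof. by rewrite sum_block_involution_sqr; apply: sum_block_irr1_sqr. Qed.

End CentralizerReduction.

(** * An irreducible character of small degree *)

Section SmallDegree.

Variables (gT : finGroupType) (G : {group gT}) (t : gT).
Hypotheses (Gt : t \in G) (inv_t : involution t).

Local Notation C := 'C_G[t]%G.
Local Notation K := (t ^: G).
Local Notation I := (involutions 'C_G[t]).
Local Notation Sec := (two_section G t).
Local Notation core := 'O_2^'(C).

Lemma class_involution a : a \in K -> involution a.
Proof. by case/imsetP=> h _ ->; rewrite involutionJ. Qed.

(** An involution a such that a x is an involution inverts x, hence its 2-part;
    as the latter is an involution, a commutes with it. *)
Lemma card_inverting_involutions x :
  x \in Sec -> #|[set a in K | a^-1 * x \in K]| <= #|I|.
Proof.
case/setIdP=> Gx /imsetP[g Gg x2]; rewrite -(cardJg I g).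
apply/subset_leq_card/subsetP=> a /setIdP[Ka Kax].
have Ga : a \in G := subsetP (class_subG Gt (subxx G)) a Ka.
have inv_a := class_involution Ka; have inv_ax := class_involution Kax.
rewrite mem_conjg inE involutionJ inv_a andbT.
have Dx : x ^ a = x^-1.
  have := involutionV inv_ax; rewrite invMg invgK => xa.
  by rewrite conjgE mulgA -xa -[X in _ * X](involutionV inv_a) mulgK.
have cxa : x.`_2 ^ a = x.`_2.
  by rewrite -consttJ Dx consttV x2 involutionV ?involutionJ.
rewrite -mem_conjg conjIg conjGid // inE Ga /=.
by rewrite -normJ conjg_set1 -x2; apply/cent1P/esym/commgP/conjg_fixP.
Qed.

(** Each conjugate s of t is the 2-part of every product of s by an element of
    the largest odd order normal subgroup of its centralizer. *)
Lemma card_two_section_ge : #|G| <= #|C : 'O_2^'(C)| * #|Sec|.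
Proof.
have sOC : 'O_2^'(C) \subset C := pcore_sub _ _.
have -> : #|G| = (#|C : 'O_2^'(C)| * (#|K| * #|'O_2^'(C)|))%N.
  by rewrite -(Lagrange (subsetIl G 'C[t])) -(Lagrange sOC) -index_cent1; ring.
rewrite leq_mul2l; apply/orP; right.
rewrite -[#|Sec|]sum1_card (partition_big (fun x => x.`_2) [in K]) /=; last first.
  by move=> x /setIdP[].
rewrite -sum_nat_const; apply: leq_sum => s /imsetP[g Gg ->]; rewrite sum1_card.
rewrite -(card_imset 'O_2^'(C) (inj_comp (conjg_inj g) (mulgI t))).
apply/subset_leq_card/subsetP=> _ /imsetP[y Oy ->]; rewrite unfold_in inE /=.
have /setIP[Gy /cent1P cty] := subsetP sOC y Oy.
have y2 : y.`_2 = 1 by apply/constt1P; apply: mem_p_elt (pcore_pgroup _ _) Oy.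
rewrite groupJ ?groupM //= consttJ consttM // y2 mulg1 constt_involution //.
by rewrite eqxx imset_f.
Qed.

Local Open Scope ring_scope.

Lemma central_value_class (i : Iirr G) :
  central_value K i = #|K|%:R * 'chi_i t / 'chi_i 1%g.
Proof.
rewrite /central_value (eq_bigr (fun=> 'chi_i t)) => [|_ /imsetP[h Gh ->]].
  by rewrite sumr_const -[_ *+ _]mulr_natl.
by rewrite cfunJ.
Qed.

(** The left side is a multiple of the number of pairs of conjugates of t with
    product in the 2-section, counted as walks of length 2 in the Cayley graph
    of the conjugacy class of t; each product arises from at most |I| pairs. *)
Lemma sum_section_irr_le :
  \sum_i 'chi[G]_i t ^+ 2 * section_sum t i / 'chi_i 1%g * #|G|%:R
    <= #|C|%:R ^+ 2 * #|I|%:R * #|Sec|%:R.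
Proof.
have sKG : K \subset G := class_subG Gt (subxx G).
have nKG : G \subset 'N(K) := class_norm t G.
have cardG : #|G|%:R = #|K|%:R * #|C|%:R :> algC.
  by rewrite -natrM -index_cent1 mulnC Lagrange // subsetIl.
have nzG : #|G|%:R != 0 :> algC := neq0CG G.
have /andP[nzK nzC] : (#|K|%:R != 0 :> algC) && (#|C|%:R != 0 :> algC).
  by rewrite -negb_or -mulf_eq0 -cardG.
(* Walks 1, a, a b with a and b in K. *)
have countE : \sum_(x in Sec) (walks (cayley_edge G K) 1 1%g x)%:R
    = \sum_i 'chi[G]_i t ^+ 2 * section_sum t i / 'chi_i 1%g * #|G|%:R / #|C|%:R ^+ 2 :> algC.
  under eq_bigr => x t_x.
    rewrite walks_cayley ?group1 ?(subsetP (two_section_sub G t) x) //; over.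
  rewrite -[LHS]mulr_suml exchange_big mulr_suml; apply: eq_bigr => i _ /=.
  rewrite -mulr_sumr central_value_class.
  rewrite (_ : \sum_(x in _) _ = section_sum t i); last first.
    rewrite [RHS](reindex_inj invg_inj) /=.
    rewrite [RHS](eq_bigl _ _ (fun x => two_section_inv G x inv_t)).
    by apply: eq_bigr => x _; rewrite mulg1.
  rewrite cardG; move: ('chi_i 1%g) (irr1_neq0 i) => d nz_d.
  by field; rewrite nz_d nzK nzC.
have count_le : \sum_(x in Sec) (walks (cayley_edge G K) 1 1%g x)%:R
    <= \sum_(x in Sec) #|I|%:R :> algC.
  apply: ler_sum => x t_x; rewrite ler_nat.
  apply: leq_trans (card_inverting_involutions t_x).
  rewrite walksS -sum1_card big_mkcond [X in (_ <= X)%N]big_mkcond /=.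
  apply: leq_sum => a _; rewrite walks0 /cayley_edge /= group1 invg1 mul1g inE.
  by case: (a \in K) => //=; rewrite andbC; case: (_ \in K) => //=; case: (a \in G).
rewrite countE sumr_const -mulr_suml ler_pdivrMr ?exprn_gt0 ?ltr0n ?cardG_gt0 // in count_le.
by apply: le_trans count_le _; rewrite -[_ *+ _]mulr_natl mulrC mulrA mulrAC.
Qed.

(** The sum of the squares of the section sums is |G| |S|. *)
Lemma norm_section_sum_le (i : Iirr G) :
  `|section_sum t i| <= #|C : core|%:R * #|Sec|%:R.
Proof.
have n_gt0 : (0 < #|C : core|)%N by apply: indexg_gt0.
have real_s j : section_sum t j \is Num.real by rewrite Rreal_int ?section_sum_Cint.
rewrite -(@ler_pXn2r _ 2) ?nnegrE ?mulr_ge0 ?ler0n //.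
rewrite real_normK //.
have : section_sum t i ^+ 2 <= #|G|%:R * #|Sec|%:R.
  rewrite -(sum_section_sum_sqr G inv_t) (bigD1 i) //= lerDl.
  by apply: sumr_ge0 => j _; rewrite -realEsqr.
move/le_trans; apply; rewrite -!natrM -natrX ler_nat.
apply: (@leq_trans (#|C : core| * #|Sec| * #|Sec|)).
  by rewrite leq_mul2r card_two_section_ge orbT.
rewrite expnMn -mulnA -mulnn -!mulnA leq_mul2l; apply/orP; right.
by rewrite leq_pmull.
Qed.

(** If all nontrivial characters had degree larger than D = n^2 (q + 1), with n
    the index of O(C) in C, then their terms in [sum_section_irr_le] would
    cancel at most the fraction n^2 / D = 1 / (q + 1) of the trivial term. *)
Lemma exists_small_irr (q : nat) :
  (q.+1 * (#|C| ^ 2 * #|I|) < q * #|G|)%N ->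
  exists2 i : Iirr G, i != 0 & 'chi_i 1%g <= (#|C : core| ^ 2 * q.+1)%:R.
Proof.
set n := #|C : _|; set D := (n ^ 2 * q.+1)%N => ltG.
have [i /andP[nz_i le_iD] | large] :=
  pickP (fun i : Iirr G => (i != 0) && ('chi_i 1%g <= D%:R)); first by exists i.
have n_gt0 : (0 < n)%N by apply: indexg_gt0.
have D_gt0 : (0 < D)%N by rewrite muln_gt0 expn_gt0 n_gt0.
have Sec_gt0 : (0 < #|Sec|)%N.
  by have := leq_trans (cardG_gt0 G) card_two_section_ge; rewrite muln_gt0 => /andP[].
pose s : algC := #|Sec|%:R; pose g : algC := #|G|%:R.
have s_gt0 : 0 < s by rewrite ltr0n.
have g_gt0 : 0 < g by rewrite ltr0n cardG_gt0.
have chi_t_ge0 i : 0 <= 'chi[G]_i t ^+ 2.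
  by rewrite -realEsqr Rreal_int ?irr_involution_Cint.
have term_ge (i : Iirr G) : i != 0 ->
    - ((if in_principal_block i then 'chi_i t ^+ 2 else 0) * (n%:R * s / D%:R * g))
    <= 'chi_i t ^+ 2 * section_sum t i / 'chi_i 1%g * g.
  move=> nz_i; case: ifPn => [_ | B'i]; last first.
    by rewrite mul0r oppr0 section_sum_block_eq0 // mulr0 !mul0r.
  have ltD : D%:R < 'chi_i 1%g.
    rewrite real_ltNge ?Rreal_nat ?Cnat_irr1 ?rpred_nat //.
    by have := large i; rewrite nz_i /= => ->.
  have chi1_gt0 : 0 < 'chi_i 1%g := irr1_gt0 i.
  have norm_le : `|section_sum t i / 'chi_i 1%g| <= n%:R * s / D%:R.
    rewrite normrM normfV (gtr0_norm chi1_gt0) ler_pM ?norm_section_sum_le //.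
      by rewrite invr_ge0 ltW.
    by rewrite lef_pV2 ?posrE ?ltr0n // ltW.
  rewrite (_ : 'chi_i t ^+ 2 * _ / _ * g
             = 'chi_i t ^+ 2 * (section_sum t i / 'chi_i 1%g * g)); last by rewrite !mulrA.
  rewrite -mulrN ler_wpM2l // -mulNr ler_wpM2r ?(ltW g_gt0) //.
  apply: real_lerNnormlW norm_le.
  by rewrite rpred_div ?Rreal_int ?section_sum_Cint // intr_nat ?Cnat_irr1.
have sum_ge : (1 - n%:R * n%:R / D%:R) * (s * g)
    <= \sum_i 'chi[G]_i t ^+ 2 * section_sum t i / 'chi_i 1%g * g.
  rewrite (bigD1 0) //= section_sum0 irr0 !cfun1E group1 Gt.
  rewrite expr1n mul1r divr1 mulrBl mul1r -/s lerD2l.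
  apply: le_trans (ler_sum _ term_ge).
  rewrite sumrN lerN2 -mulr_suml.
  apply: (@le_trans _ _ (n%:R * (n%:R * s / D%:R * g))).
    rewrite ler_wpM2r ?mulr_ge0 ?invr_ge0 ?ler0n ?(ltW g_gt0) ?(ltW s_gt0) //.
    apply: le_trans (sum_block_involution_sqr_le Gt inv_t).
    rewrite -big_mkcondr /= big_mkcond [X in _ <= X]big_mkcond; apply: ler_sum => i _.
    by case: (in_principal_block i); rewrite ?andbF ?andbT //=; case: ifP.
  by rewrite [leLHS](_ : _ = n%:R * n%:R / D%:R * (s * g)) //; ring.
have := le_trans sum_ge sum_section_irr_le.
have -> : 1 - n%:R * n%:R / D%:R = q%:R / q.+1%:R :> algC.
  rewrite /D natrM natrX -natr1.
  have nz_n : n%:R != 0 :> algC by rewrite pnatr_eq0 -lt0n.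
  have nz_q : q%:R + 1 != 0 :> algC by rewrite natr1 pnatr_eq0.
  by field; rewrite nz_q nz_n.
rewrite mulrA [leLHS]mulrAC ler_pM2r // mulrAC ler_pdivrMr ?ltr0n //.
rewrite -natrX -!natrM ler_nat mulnC [(_ * q.+1)%N]mulnC => leG.
by have := leq_ltn_trans leG ltG; rewrite mulnC ltnn.
Qed.

End SmallDegree.

(** * Simple groups with a representation of small degree *)

Section Unitary.

Local Open Scope ring_scope.
Local Open Scope sesquilinear_scope.

Lemma ctmx_mul m n p (A : 'M[algC]_(m, n)) (B : 'M_(n, p)) :
  (A *m B) ^t* = B ^t* *m A ^t*.
Proof. by rewrite trmx_mul map_mxM. Qed.

(** The square of the Hilbert-Schmidt norm. *)
Definition hs_norm2 m n (A : 'M[algC]_(m, n)) : algC := \sum_i \sum_j `|A i j| ^+ 2.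

Lemma hsE m n (A : 'M[algC]_(m, n)) : hs_norm2 A = \tr (A *m A ^t*).
Proof.
apply: eq_bigr => i _; rewrite mxE; apply: eq_bigr => j _.
by rewrite !mxE normCK.
Qed.

Lemma hs_ge0 m n (A : 'M[algC]_(m, n)) : 0 <= hs_norm2 A.
Proof. by do 2![apply: sumr_ge0 => ? _]; rewrite exprn_ge0. Qed.

Lemma hs_eq0 m n (A : 'M[algC]_(m, n)) : hs_norm2 A = 0 -> A = 0.
Proof.
move/eqP; rewrite psumr_eq0 => [/allP A0 | i _]; last first.
  by apply: sumr_ge0 => ? _; rewrite exprn_ge0.
apply/matrixP=> i j; have := A0 i (mem_index_enum _) => /=.
rewrite psumr_eq0 => [/allP/(_ j (mem_index_enum _)) | ? _]; last exact: exprn_ge0.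
by rewrite /= sqrf_eq0 normr_eq0 mxE => /eqP.
Qed.

Lemma hs_mul m n p (A : 'M[algC]_(m, n)) (B : 'M_(n, p)) :
  hs_norm2 (A *m B) <= hs_norm2 A * hs_norm2 B.
Proof.
have CS i k : `|(A *m B) i k| ^+ 2
    <= (\sum_j `|A i j| ^+ 2) * (\sum_j `|B j k| ^+ 2).
  have [+ _] := CauchySchwarz (@dotmx algC n) (row i A) (row k (B ^t*)).
  rewrite /= !dotmxE !mxE.
  congr (`|_| ^+ 2 <= _ * _); apply: eq_bigr => j _; rewrite !mxE ?conjCK //.
    by rewrite normCK.
  by rewrite normCK mulrC.
have -> : hs_norm2 B = \sum_k \sum_j `|B j k| ^+ 2 by rewrite /hs_norm2 exchange_big.
rewrite mulr_suml; apply: ler_sum => i _; rewrite mulr_sumr.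
by apply: ler_sum => k _; apply: CS.
Qed.

Lemma hsB m n (A B : 'M[algC]_(m, n)) : hs_norm2 (A - B) <= 2 * (hs_norm2 A + hs_norm2 B).
Proof.
rewrite mulrDr !mulr_sumr -big_split; apply: ler_sum => i _ /=.
rewrite !mulr_sumr -big_split; apply: ler_sum => j _ /=; rewrite !mxE.
rewrite -subr_ge0 (_ : _ - _ = `|A i j + B i j| ^+ 2) ?exprn_ge0 //.
by rewrite !normCK !rmorphB !rmorphD /=; ring.
Qed.

Lemma hs_unitaryl n (U A : 'M[algC]_n) : U \is unitarymx -> hs_norm2 (U *m A) = hs_norm2 A.
Proof.
move/unitarymxP/mulmx1C=> UU.
by rewrite !hsE ctmx_mul -mulmxA mxtrace_mulC -!mulmxA UU mulmx1.
Qed.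

Lemma hs_unitaryr n (U A : 'M[algC]_n) : U \is unitarymx -> hs_norm2 (A *m U) = hs_norm2 A.
Proof.
by move/unitarymxP=> UU; rewrite !hsE ctmx_mul mulmxA -[A *m U *m _]mulmxA UU mulmx1.
Qed.

Lemma norm_unitary_le1 n (U : 'M[algC]_n) i j : U \is unitarymx -> `|U i j| <= 1.
Proof.
move/unitarymxP/matrixP/(_ i i); rewrite !mxE eqxx => UU.
rewrite -(@expr_le1 _ 2) // -[leRHS]UU (bigD1 j) //= !mxE -normCK lerDl.
by apply: sumr_ge0 => k _; rewrite !mxE -normCK exprn_ge0.
Qed.

(** The sum H of the matrices A A^* over the group is positive definite and
    satisfies A H A^* = H for every A in the group; with H = P^* D P its spectral
    decomposition, D^(-1/2) P conjugates the representation to a unitary one. *)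
Lemma repr_unitarizable (gT : finGroupType) (G : {group gT}) d
    (rG : mx_representation algC G d) :
  exists2 Q : 'M[algC]_d, Q \in unitmx &
    forall x, x \in G -> Q *m rG x *m invmx Q \is unitarymx.
Proof.
pose H := \sum_(g in G) rG g *m (rG g) ^t*.
have HJ x : x \in G -> rG x *m H *m (rG x)^t* = H.
  move=> Gx; rewrite mulmx_sumr mulmx_suml [RHS](reindex_inj (mulgI x)) /=.
  apply: eq_big => g; first by rewrite groupMl.
  by move=> Gg; rewrite repr_mxM // ctmx_mul !mulmxA.
have ctH : H^t* = H.
  rewrite /H raddf_sum /= raddf_sum /=; apply: eq_bigr => g _.
  by rewrite ctmx_mul trmxCK.
have /orthomx_spectralP defH : H \is normalmx by apply/normalmxP; rewrite ctH.
set P := spectralmx H in defH; set D := spectral_diag H in defH.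
have uP : P \is unitarymx := spectral_unitarymx H.
have PH : P *m H *m P^t* = diag_mx D.
  have Pu := unitarymx_unit uP.
  by rewrite -invmx_unitary // [X in P *m X]defH !mulmxA mulmxV // mul1mx mulmxK.
have D_gt0 i : 0 < D 0 i.
  have <- : (P *m H *m P^t*) i i = D 0 i by rewrite PH mxE eqxx.
  rewrite mulmx_sumr mulmx_suml summxE (bigD1 1%g) //= repr_mx1.
  rewrite mul1mx trmx1 map_mx1 mulmx1 (unitarymxP uP) mxE eqxx.
  rewrite ltr_pwDl ?ltr01 //; apply: sumr_ge0 => g _.
  rewrite mulmxA -mulmxA -ctmx_mul mxE; apply: sumr_ge0 => k _.
  by rewrite !mxE mul_conjC_ge0.
(* The term of H at the identity alone makes every D 0 i at least 1. *)
pose s := \row_i (sqrtC (D 0 i))^-1 : 'rV[algC]_d.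
pose Q := diag_mx s *m P.
have QH : Q *m H *m Q^t* = 1%:M.
  rewrite ctmx_mul !mulmxA -[_ *m P *m H]mulmxA -[_ *m (P *m H) *m _]mulmxA PH.
  rewrite tr_diag_mx map_diag_mx !mulmx_diag; apply/matrixP=> i j.
  rewrite !mxE; case: eqP => // _; rewrite !mulr1n.
  have s_gt0 : 0 < sqrtC (D 0 i) by rewrite sqrtC_gt0.
  rewrite [X in _ * X](_ : _ = (sqrtC (D 0 i))^-1); last first.
    by apply: conj_Creal; rewrite rpredV gtr0_real.
  by rewrite -[X in _ * X * _]sqrtCK; field; rewrite gt_eqF.
have [Qu _] := mulmx1_unit (etrans (mulmxA _ _ _) QH).
clearbody Q; exists Q => // x Gx; apply/unitarymxP.
have QtV : (invmx Q)^t* = Q *m H.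
  by rewrite -[LHS]mul1mx -QH -[LHS]mulmxA -ctmx_mul mulVmx // trmx1 map_mx1 mulmx1.
rewrite !ctmx_mul QtV !mulmxA mulmxKV // -[Q *m rG x *m H]mulmxA.
by rewrite -[_ *m (rG x)^t*]mulmxA HJ.
Qed.

Section SmallRepresentation.

Variables (gT : finGroupType) (G : {group gT}) (d : nat).
Variable U : gT -> 'M[algC]_d.
Hypotheses (UM : {in G &, forall x y, U (x * y)%g = U x *m U y}).
Hypothesis (unitU : forall x, x \in G -> U x \is unitarymx).
Hypothesis (injU : {in G, forall x, U x = 1%:M -> x = 1%g}).

Lemma hs_repr_eq x y : x \in G -> y \in G ->
  hs_norm2 (U x - U y) = hs_norm2 (U (y^-1 * x)%g - 1%:M).
Proof.
move=> Gx Gy; rewrite -(hs_unitaryl (U (y^-1 * x)%g - 1%:M) (unitU Gy)).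
by rewrite mulmxBr mulmx1 -UM ?groupM ?groupV // mulKVg.
Qed.

Lemma hs_reprJ x y : x \in G -> y \in G -> hs_norm2 (U (x ^ y)%g - 1%:M) = hs_norm2 (U x - 1%:M).
Proof.
move=> Gx Gy; rewrite -(hs_unitaryr (U x - 1%:M) (unitU Gy)).
by rewrite mulmxBl mul1mx -UM // hs_repr_eq ?groupM // conjgE.
Qed.

(** Up to unitary factors, [x, y] - 1 is the commutator of the matrices of x and y,
    which is that of x - 1 and y - 1. *)
Lemma hs_commg x y : x \in G -> y \in G ->
  hs_norm2 (U [~ x, y] - 1%:M) <= 4 * (hs_norm2 (U x - 1%:M) * hs_norm2 (U y - 1%:M)).
Proof.
move=> Gx Gy; have -> : [~ x, y] = ((y * x)^-1 * (x * y))%g.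
  by rewrite commgEl conjgE invMg !mulgA.
rewrite -hs_repr_eq ?groupM // !UM //.
rewrite (_ : _ - _ = (U x - 1%:M) *m (U y - 1%:M) - (U y - 1%:M) *m (U x - 1%:M)).
  apply: le_trans (hsB _ _) _.
  rewrite (_ : 4 * _ = 2 * (hs_norm2 (U x - 1%:M) * hs_norm2 (U y - 1%:M)
                      + hs_norm2 (U y - 1%:M) * hs_norm2 (U x - 1%:M))); last by ring.
  by rewrite ler_wpM2l ?ler0n // lerD ?hs_mul.
rewrite !mulmxBl !mulmxBr !mulmx1 !mul1mx.
move: (U x *m U y) (U y *m U x) => A B; apply/matrixP=> i j; rewrite !mxE.
by ring.
Qed.

Hypotheses (simpleG : simple G) (nonabG : ~~ abelian G).

(** Let m <> 1 be as close to 1 as possible.  If its squared distance from 1 were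
    less than 1 / 4, the commutators of m with its conjugates would be closer to
    1 than m, hence trivial, and the conjugates of m would generate an abelian
    normal subgroup. *)
Lemma hs_repr_ge x : x \in G -> x != 1%g -> 1 / 4 <= hs_norm2 (U x - 1%:M).
Proof.
move=> Gx nt_x; pose h y := hs_norm2 (U y - 1%:M).
have real_h y : h y \is Num.real by rewrite ger0_real ?hs_ge0.
pose P y := (y \in G) && (y != 1%g).
have Px : P x by rewrite /P Gx.
(* The order on algC is only partial, but the distances are all real. *)
have [] := @Order.POrderTheory.comparable_arg_minP _ algC gT x P h Px.
  by move=> y z _ _; apply: real_comparable.
move=> m /andP[Gm nt_m] min_m; apply: le_trans (min_m x Px).
have real4 : 1 / 4 \is @Num.real algC by rewrite ger0_real ?divr_ge0 ?ler0n.
rewrite real_leNgt //; apply/negP=> lt_m4; case/negP: nonabG.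
have hm_gt0 : 0 < h m.
  rewrite lt_neqAle hs_ge0 andbT eq_sym; apply: contraNneq nt_m => /hs_eq0/eqP.
  by rewrite subr_eq0 => /eqP/(injU Gm)->.
have comm_m g : g \in G -> commute m (m ^ g)%g.
  move=> Gg; apply/commgP; apply: contraLR lt_m4 => nt_c.
  rewrite -real_leNgt //.
  have := min_m _ (_ : P [~ m, m ^ g]); rewrite /P nt_c groupR ?groupJ // => /(_ isT) le_c.
  have := le_trans le_c (hs_commg Gm (groupJ Gm Gg)); rewrite hs_reprJ // -/(h m).
  by rewrite mulrA -[leLHS]mul1r ler_pM2r // ler_pdivrMr ?ltr0n // mulrC.
have defG : <<m ^: G>>%g = G.
  have nsG : <<m ^: G>>%g <| G.
    by rewrite /normal gen_subG class_subG //= norms_gen ?class_norm.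
  have [_ /(_ _ nsG)[] //] := simpleP _ simpleG.
  move/trivgP; rewrite gen_subG => /subsetP/(_ m (class_refl _ _))/set1P eq_m1.
  by rewrite eq_m1 eqxx in nt_m.
rewrite -defG abelian_gen; apply/centsP=> _ /imsetP[a Ga ->] _ /imsetP[b Gb ->].
have /(congr1 (conjg^~ a)) := comm_m _ (groupM Gb (groupVr Ga)).
by rewrite /= [LHS]conjMg [RHS]conjMg -!conjgM mulgKV.
Qed.


Hypothesis d_gt0 : (0 < d)%N.

(** The real and imaginary parts of matrix entries lie in [-1, 1]; cutting this
    interval into pieces of length 1 / (3 d) puts distinct group elements in
    distinct cells, since two matrices in the same cell are at squared distance
    at most 2 / 9 < 1 / 4. *)
Lemma card_repr_le : (#|G| <= ((6 * d).+1 ^ 2) ^ (d * d))%N.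
Proof.
pose N := (6 * d)%N; pose M : algC := (3 * d)%:R.
have M_gt0 : 0 < M by rewrite ltr0n muln_gt0.
pose cell (r : algC) : 'I_N.+1 := inord (Num.truncn ((r + 1) * M)).
have cellP r s : r \is Num.real -> s \is Num.real -> `|r| <= 1 -> `|s| <= 1 ->
    cell r = cell s -> (r - s) ^+ 2 <= (M ^+ 2)^-1.
  move=> Rr Rs r1 s1 eq_rs.
  have bnd u : u \is Num.real -> `|u| <= 1 -> 0 <= (u + 1) * M <= N%:R.
    move=> Ru; rewrite real_ler_norml // => /andP[ge_m1 le_1].
    rewrite mulr_ge0 ?(ltW M_gt0) -?lerBlDr ?sub0r //=.
    rewrite (_ : N%:R = 2 * M); last by rewrite -natrM mulnA.
    by rewrite ler_wpM2r ?(ltW M_gt0) // -lerBrDr; apply: le_trans le_1 _; rewrite lerBrDr.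
  have tr u : u \is Num.real -> `|u| <= 1 -> (Num.truncn ((u + 1) * M) < N.+1)%N.
    move=> Ru u1; have /andP[u_ge0 u_le] := bnd u Ru u1.
    rewrite ltnS -(ler_nat algC); apply: le_trans u_le.
    by have /andP[] := truncn_itv u_ge0.
  have {eq_rs} := congr1 val eq_rs; rewrite /= !inordK ?tr // => eq_tr.
  have /andP[r0 _] := bnd r Rr r1; have /andP[s0 _] := bnd s Rs s1.
  have := truncn_itv r0; have := truncn_itv s0; rewrite eq_tr.
  set k := Num.truncn _ => /andP[s_ge s_lt] /andP[r_ge r_lt].
  have Rd : (r - s) * M \is Num.real by rewrite rpredM ?rpredB // gtr0_real.
  have: `|(r - s) * M| <= 1.
    rewrite real_ler_norml // (_ : (r - s) * M = (r + 1) * M - (s + 1) * M); last by ring.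
    rewrite -natr1 in r_lt s_lt; apply/andP; split.
      by rewrite lerBrDr addrC; apply: (@le_trans _ _ k%:R); rewrite // lerBlDr ltW.
    by rewrite lerBlDr [leRHS]addrC; apply: le_trans (ltW r_lt) _; rewrite lerD2r.
  rewrite -(@expr_le1 _ 2) // real_normK // exprMn => le1.
  by rewrite -[leRHS]mul1r ler_pdivlMr ?exprn_gt0.
pose box x : {ffun 'I_d * 'I_d -> 'I_N.+1 * 'I_N.+1} :=
  [ffun ij => (cell ('Re (U x ij.1 ij.2)), cell ('Im (U x ij.1 ij.2)))].
suff inj_box : {in G &, injective box}.
  rewrite -(card_in_imset inj_box); apply: leq_trans (max_card _) _.
  by rewrite card_ffun !card_prod !card_ord mulnn.
move=> x y Gx Gy /ffunP eq_box; apply/eqP.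
have Gyx : (y^-1 * x)%g \in G by rewrite groupM ?groupV.
rewrite eq_sym eq_mulVg1; apply: contraT => nt_yx.
have := hs_repr_ge Gyx nt_yx; rewrite -hs_repr_eq // => ge4.
have Re1 z i j : z \in G -> `|'Re (U z i j)| <= 1.
  move=> Gz; have [+ _] := leif_normC_Re_Creal (U z i j) => /le_trans; apply.
  exact: norm_unitary_le1 (unitU Gz).
have Im1 z i j : z \in G -> `|'Im (U z i j)| <= 1.
  move=> Gz; rewrite -(@expr_le1 _ 2) // real_normK ?Creal_Im //.
  have: `|U z i j| ^+ 2 <= 1 by rewrite expr_le1 ?norm_unitary_le1 ?unitU.
  rewrite normC2_Re_Im; apply: le_trans; rewrite lerDr.
  by rewrite -realEsqr Creal_Re.
have: hs_norm2 (U x - U y) <= \sum_(i < d) \sum_(j < d) (M ^+ 2)^-1 * 2.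
  apply: ler_sum => i _; apply: ler_sum => j _; rewrite !mxE normC2_Re_Im mulr2n.
  have := eq_box (i, j); rewrite !ffunE /= => -[eqRe eqIm].
  rewrite mulrDr mulr1 !raddfB /=.
  by rewrite lerD ?cellP ?Creal_Re ?Creal_Im ?Re1 ?Im1.
rewrite !sumr_const !card_ord => /(le_trans ge4).
have nz_d : d%:R != 0 :> algC by rewrite pnatr_eq0 -lt0n.
rewrite -mulrnA -[X in _ <= X]mulr_natr /M (natrM _ 3 d) (natrM _ d d).
rewrite (_ : _ * _ * _ = 2 / 9); last by field.
by rewrite ler_pdivrMr ?ltr0n // mulrAC ler_pdivlMr ?ltr0n // mul1r -(natrM _ 2 4) ler_nat.
Qed.


End SmallRepresentation.

End Unitary.

Lemma card_simple_le (gT : finGroupType) (G : {group gT}) (i : Iirr G) (D : nat) :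
  simple G -> ~~ abelian G -> i != 0%R -> ('chi_i 1%g <= D%:R)%R ->
  #|G| <= ((6 * D).+1 ^ 2) ^ (D * D).
Proof.
move=> simpleG nonabG nz_i le_iD; pose d := irr_degree (socle_of_Iirr i).
have le_dD : d <= D by rewrite -(ler_nat algC) -irr1_degree.
apply: (@leq_trans (((6 * d).+1 ^ 2) ^ (d * d))); last first.
  apply: (@leq_trans (((6 * D).+1 ^ 2) ^ (d * d))).
    by rewrite leq_exp2r ?muln_gt0 ?irr_degree_gt0 // leq_exp2r // ltnS leq_mul2l.
  by rewrite leq_pexp2l ?expn_gt0 // leq_mul.
have [Q Qu unitQ] := repr_unitarizable 'Chi_i.
apply: (@card_repr_le _ G d (fun x => Q *m 'Chi_i x *m invmx Q)%R) => //.
- by move=> x y Gx Gy; rewrite repr_mxM // !mulmxA mulmxKV.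
- move=> x Gx Ux1; have Cx1 : ('Chi_i x = 1%:M)%R.
    apply: (can_inj (mulKmx Qu)); rewrite mulmx1.
    by rewrite -[LHS](mulmxKV Qu) Ux1 mul1mx.
  have : x \in cfker ('chi_i)%R.
    by rewrite cfkerEirr inE -irrRepr !cfunE Gx group1 Cx1 repr_mx1.
  have [_ /(_ _ (cfker_normal ('chi_i)%R))[-> /set1P//|/eqP]] := simpleP _ simpleG.
  by rewrite eqEsubset subGcfker (negPf nz_i) andbF.
exact: irr_degree_gt0.
Qed.

(** * Groups of bounded order *)

Section FinitelyManyGroups.

Definition perm_rank (T : finType) (s : {perm T}) : 'S_#|T| :=
  perm (inj_comp (@enum_rank_inj T) (inj_comp (@perm_inj T s) (@enum_val_inj T T))).

Lemma perm_rankM (T : finType) :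
  {in [set: {perm T}] &, {morph @perm_rank T : s t / s * t}}.
Proof.
by move=> s t _ _; apply/permP=> i; rewrite permM !permE /= enum_rankK permM.
Qed.

Canonical perm_rank_morphism T := Morphism (@perm_rankM T).

Lemma injm_perm_rank T : 'injm (@perm_rank T).
Proof.
apply/injmP=> s t _ _ /permP eq_st; apply/permP=> x.
have := eq_st (enum_rank x); rewrite !permE /= !enum_rankK.
exact: enum_rank_inj.
Qed.

(** Cayley's theorem, with a symmetric group that depends only on the order. *)
Lemma isog_symmetric_subgroup (gT : finGroupType) (G : {group gT}) :
  exists H : {group 'S_#|G|}, G \isog H.
Proof.
have isoS := isog_trans (isog_subg G) (Cayley_isog [subg G]).
have cardS : #|subg_of G| = #|G| by rewrite -cardsT (card_isog (isog_subg G)).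
rewrite -cardS; exists (@perm_rank_morphism _ @* (Cayley_repr [subg G] @* [subg G]))%G.
apply: isog_trans isoS _; apply: sub_isog (subsetT _) _.
exact: injm_perm_rank.
Qed.

(** The subgroups of the symmetric groups of degree at most M serve as
    representatives. *)
Lemma finitely_many_of_bounded_order
    (P : forall gT : finGroupType, {group gT} -> Prop) (M : nat) :
  (forall (gT : finGroupType) (G : {group gT}), P gT G -> #|G| <= M) ->
  finitely_many_up_to_isog P.
Proof.
move=> boundP; pose T : finType := {m : 'I_M.+1 & {group 'S_m}}.
pose u (i : 'I_#|T|) : T := enum_val i.
exists #|T|, (fun i => 'S_(tag (u i))), (fun i => tagged (u i)).
move=> gT G /boundP leGM; have [H isoH] := isog_symmetric_subgroup G.
have ltGM : #|G| < M.+1 by [].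
pose v : T := Tagged (fun m : 'I_M.+1 => {group 'S_m}) (H : {group 'S_(Ordinal ltGM)}).
by exists (enum_rank v); rewrite /u enum_rankK.
Qed.

End FinitelyManyGroups.

Theorem theorem1p3 (R : realType) (n : nat) (eps : R)
    (n_gt0 : 0 < n) (eps_gt0 : (0 < eps)%R) :
  finitely_many_up_to_isog (fun (gT : finGroupType) (G : {group gT}) =>
    simple G /\
    exists t : gT,
      [/\ t \in G, involution t,
          #|'C_G[t] : 'O_2^'('C_G[t])| = n
        & ((1 + eps) * #|'C_G[t]|%:R ^+ 2 * #|involutions 'C_G[t]|%:R
            < #|G|%:R)%R]).
Proof.
(* It suffices that 1 / q <= eps. *)
pose q := (Num.truncn eps^-1%R).+1.
have q_eps : (1 <= q%:R * eps)%R by rewrite -ler_pdivrMr // div1r ltW // truncnS_gt.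
pose D := (n ^ 2 * q.+1)%N.
apply: (@finitely_many_of_bounded_order _ (maxn 2 (((6 * D).+1 ^ 2) ^ (D * D)))).
move=> gT G [simpleG [t [Gt inv_t index_n large_G]]]; rewrite leq_max.
(* An abelian simple group containing an involution has order 2. *)
have [abG | nonabG] := boolP (abelian G); apply/orP; [left | right].
  have pr_G : prime #|G| := simple_sol_prime (abelian_sol abG) simpleG.
  have : 2 %| #|G| by rewrite -(eqP inv_t) order_dvdG.
  by rewrite dvdn_prime2 // => /eqP <-.
have [|i nz_i le_iD] := exists_small_irr Gt inv_t (q := q).
  rewrite -(ltr_nat R) (natrM _ q.+1) (natrM _ q) (natrM _ (_ ^ 2)) natrX.
  apply: le_lt_trans
    (_ : q%:R * ((1 + eps) * #|'C_G[t]|%:R ^+ 2 * #|involutions 'C_G[t]|%:R) < _)%R.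
    rewrite -[((1 + eps) * _ * _)%R]mulrA [leRHS]mulrA ler_wpM2r ?mulr_ge0 ?exprn_ge0 ?ler0n //.
    by rewrite mulrDr mulr1 -natr1 lerD2l.
  by rewrite ltr_pM2l ?ltr0n.
by apply: card_simple_le simpleG nonabG nz_i _; rewrite /D -index_n.
Qed.
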